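(* Let $q\in\mathbb{C}$ with $0<|q|<1$, let $t_1,t_2,t_3$ be mutually distinct non-zero complex numbers, and let $h_1,h_2,h_3,l_1,l_2,l_3,\alpha$ be parameters. Set $\lambda=(h_1+h_2+h_3-l_1-l_2-l_3+1)/2$. Consider the equation $$(x-q^{h_1+1/2}t_1)(x-q^{h_2+1/2}t_2)(x-q^{h_3+1/2}t_3)g(x/q)$$ $$+q^{2\alpha+1}(x-q^{l_1-1/2}t_1)(x-q^{l_2-1/2}t_2)(x-q^{l_3-1/2}t_3)g(qx)$$ $$+q^{\alpha}\Big[-(q+1)x^3+q^{1/2}\{(q^{h_1}+q^{l_1})t_1+(q^{h_2}+q^{l_2})t_2+(q^{h_3}+q^{l_3})t_3\}x^2$$ $$-q^{(h_1+h_2+h_3+l_1+l_2+l_3+1)/2}\{(q^{-h_1}+q^{-l_1})t_2t_3+(q^{-h_2}+q^{-l_2})t_1t_3+(q^{-h_3}+q^{-l_3})t_1t_2\}x$$ $$+q^{(h_1+h_2+h_3+l_1+l_2+l_3)/2}(q+1)t_1t_2t_3\Big]g(x)+q^{\alpha}(1-q^\lambda)x^{\lambda-\alpha+2}=0.\qquad(\ast)$$ (i) Let $(i,i',i'')$ be a permutation of $(1,2,3)$. The function $$g_i^{\langle2\rangle}(x)=x^{\lambda-\alpha}\frac{q^{\lambda-h_i-1/2}}{t_i}\,\frac{(xq^{\lambda-h_i+1/2}/t_i,\ q^{h_{i'}-h_i+1}t_{i'}/t_i,\ q^{h_{i''}-h_i+1}t_{i''}/t_i,\ q;q)_\infty}{(xq^{-h_i+1/2}/t_i,\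 q^{\lambda+l_i-h_i},\ q^{\lambda+l_{i'}-h_i}t_{i'}/t_i,\ q^{\lambda+l_{i''}-h_i}t_{i''}/t_i;q)_\infty}$$ $$\times{}_4\phi_3\left(\begin{array}{c}xq^{-h_i+1/2}/t_i,\ q^{\lambda+l_i-h_i},\ q^{\lambda+l_{i'}-h_i}t_{i'}/t_i,\ q^{\lambda+l_{i''}-h_i}t_{i''}/t_i\\ xq^{\lambda-h_i+1/2}/t_i,\ q^{h_{i'}-h_i+1}t_{i'}/t_i,\ q^{h_{i''}-h_i+1}t_{i''}/t_i\end{array};q,q\right)$$ satisfies $(\ast)$. (ii) The function $$g_0^{\langle2\rangle}(x)=x^{\lambda-\alpha-1}\frac{(q^{-\lambda+h_1+3/2}t_1/x,\ q^{-\lambda+h_2+3/2}t_2/x,\ q^{-\lambda+h_3+3/2}t_3/x,\ q;q)_\infty}{(q^{l_1+1/2}t_1/x,\ q^{l_2+1/2}t_2/x,\ q^{l_3+1/2}t_3/x,\ q^{1-\lambda};q)_\infty}$$ $$\times{}_4\phi_3\left(\begin{array}{c}q^{l_1+1/2}t_1/x,\ q^{l_2+1/2}t_2/x,\ q^{l_3+1/2}t_3/x,\ q^{1-\lambda}\\ q^{-\lambda+h_1+3/2}t_1/x,\ q^{-\lambda+h_2+3/2}t_2/x,\ q^{-\lambda+h_3+3/2}t_3/x\end{array};q,q\right)$$ also satisfies $(\ast)$.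
   Context: Notation: $(a;q)_\infty=\prod_{j\ge0}(1-q^ja)$, $(a_1,\dots,a_r;q)_\infty=\prod_i(a_i;q)_\infty$, $(a;q)_0=1$, $(a;q)_n=\prod_{j=0}^{n-1}(1-aq^j)$, and $${}_4\phi_3\left(\begin{array}{c}a_1,a_2,a_3,a_4\\ c_1,c_2,c_3\end{array};q,z\right)=\sum_{n\ge0}\frac{(a_1;q)_n(a_2;q)_n(a_3;q)_n(a_4;q)_n}{(q;q)_n(c_1;q)_n(c_2;q)_n(c_3;q)_n}z^n.$$ Powers: a branch of $\log q$ is fixed, $q^a=e^{a\log q}$, and $x^a$ is taken with a branch chosen along each orbit $\{q^nx\}_{n\in\mathbb{Z}}$ so that $(q^nx)^a=q^{na}x^a$. The statement is understood for parameter values and $x\ne0$ for which no denominator vanishes. *)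

(* Defs.v *)
From Stdlib Require Import Reals ZArith List Permutation.
From Coquelicot Require Import Coquelicot.
Import ListNotations.
Open Scope R_scope.
Open Scope C_scope.

Definition Cexp (z : C) : C :=
  (exp (Re z) * cos (Im z), exp (Re z) * sin (Im z))%R.

(** Total limit and sum of complex sequences, in the style of Coquelicot's
    [RInt]: the limit when it exists (see the two lemmas), unspecified
    otherwise. *)
Definition CLim_seq (u : nat -> C) : C :=
  iota (T := C_CompleteNormedModule)
    (fun v => filterlim u eventually (locally (T := C_UniformSpace) v)).

Definition CSeries (a : nat -> C) : C :=
  iota (T := C_CompleteNormedModule)
    (is_series (V := C_NormedModule) a).

Lemma CLim_seq_unique (u : nat -> C) (v : C) :
  filterlim u eventually (locally (T := C_UniformSpace) v) -> CLim_seq u = v.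
Proof.
  intros H.
  apply (iota_filterlim_locally (V := C_CompleteNormedModule)
           (F := eventually) u v H).
Qed.

Lemma CSeries_unique (a : nat -> C) (v : C) :
  is_series (V := C_NormedModule) a v -> CSeries a = v.
Proof.
  intros H.
  apply (iota_filterlim_locally (V := C_CompleteNormedModule)
           (F := eventually)
           (sum_n (G := C_AbelianGroup) a) v H).
Qed.

(** [(a; q)_n] *)
Fixpoint qpoch (a q : C) (n : nat) : C :=
  match n with
  | O => 1
  | S m => qpoch a q m * (1 - a * q ^ m)
  end.

(** [(a; q)_oo] *)
Definition qpoch_inf (a q : C) : C := CLim_seq (qpoch a q).

(** [(a_1, ..., a_r; q)_oo] *)
Definition qpochs_inf (s : list C) (q : C) : C :=
  fold_right Cmult 1 (map (fun a => qpoch_inf a q) s).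

Definition phi43 (a1 a2 a3 a4 c1 c2 c3 q z : C) : C :=
  CSeries (fun n =>
    (qpoch a1 q n * qpoch a2 q n * qpoch a3 q n * qpoch a4 q n)
    / (qpoch q q n * qpoch c1 q n * qpoch c2 q n * qpoch c3 q n) * z ^ n).

Definition phi43_defined (c1 c2 c3 q : C) : Prop :=
  forall n : nat,
    qpoch q q n * qpoch c1 q n * qpoch c2 q n * qpoch c3 q n <> 0.

(** [q^a], for the branch [logq] of [log q]. *)
Definition qpow (logq a : C) : C := Cexp (a * logq).

(** [L] chooses a logarithm of every nonzero [x], coherently along each orbit
    [{q^n x}], so that the powers [x^a = exp (a * L x)] satisfy
    [(q^n x)^a = q^(n a) x^a]. *)
Definition orbit_log (logq : C) (L : C -> C) : Prop :=
  forall x : C, x <> 0 ->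
    Cexp (L x) = x /\
    forall n : Z, L (qpow logq (IZR n) * x) = L x + IZR n * logq.

Definition xpow (L : C -> C) (x a : C) : C := Cexp (a * L x).

(** The parameters [t_i, h_i, l_i] are the values at [i = 1, 2, 3] of functions
    on [nat]; their other values are never used. *)
Section Equation.

Variables (q logq : C) (L : C -> C) (t h l : nat -> C) (alpha : C).

Local Notation "'q^' a" := (qpow logq a) (at level 1, a at level 0).

Definition lambda : C := (h 1 + h 2 + h 3 - l 1 - l 2 - l 3 + 1) / 2.

Definition coef_down (x : C) : C :=
  (x - q^(h 1 + 1/2) * t 1) * (x - q^(h 2 + 1/2) * t 2)
  * (x - q^(h 3 + 1/2) * t 3).

Definition coef_up (x : C) : C :=
  q^(2 * alpha + 1)
  * ((x - q^(l 1 - 1/2) * t 1) * (x - q^(l 2 - 1/2) * t 2)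
     * (x - q^(l 3 - 1/2) * t 3)).

Definition coef_mid (x : C) : C :=
  q^alpha
  * (- (q + 1) * x ^ 3
     + q^(1/2)
       * ((q^(h 1) + q^(l 1)) * t 1 + (q^(h 2) + q^(l 2)) * t 2
          + (q^(h 3) + q^(l 3)) * t 3) * x ^ 2
     - q^((h 1 + h 2 + h 3 + l 1 + l 2 + l 3 + 1) / 2)
       * ((q^(- h 1) + q^(- l 1)) * (t 2 * t 3)
          + (q^(- h 2) + q^(- l 2)) * (t 1 * t 3)
          + (q^(- h 3) + q^(- l 3)) * (t 1 * t 2)) * x
     + q^((h 1 + h 2 + h 3 + l 1 + l 2 + l 3) / 2)
       * (q + 1) * (t 1 * t 2 * t 3)).

Definition satisfies_eq (g : C -> C) (x : C) : Prop :=
  coef_down x * g (x / q) + coef_up x * g (q * x) + coef_mid x * g x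
  + q^alpha * (1 - q^lambda) * xpow L x (lambda - alpha + 2) = 0.

Definition g_i (i i' i'' : nat) (x : C) : C :=
  xpow L x (lambda - alpha) * (q^(lambda - h i - 1/2) / t i)
  * (qpochs_inf [ x * q^(lambda - h i + 1/2) / t i;
                  q^(h i' - h i + 1) * t i' / t i;
                  q^(h i'' - h i + 1) * t i'' / t i;
                  q ] q
     / qpochs_inf [ x * q^(- h i + 1/2) / t i;
                    q^(lambda + l i - h i);
                    q^(lambda + l i' - h i) * t i' / t i;
                    q^(lambda + l i'' - h i) * t i'' / t i ] q)
  * phi43 (x * q^(- h i + 1/2) / t i)
          (q^(lambda + l i - h i))
          (q^(lambda + l i' - h i) * t i' / t i)
          (q^(lambda + l i'' - h i) * t i'' / t i)
          (x * q^(lambda - h i + 1/2) / t i)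
          (q^(h i' - h i + 1) * t i' / t i)
          (q^(h i'' - h i + 1) * t i'' / t i)
          q q.

Definition g_i_defined (i i' i'' : nat) (x : C) : Prop :=
  qpochs_inf [ x * q^(- h i + 1/2) / t i;
               q^(lambda + l i - h i);
               q^(lambda + l i' - h i) * t i' / t i;
               q^(lambda + l i'' - h i) * t i'' / t i ] q <> 0 /\
  phi43_defined (x * q^(lambda - h i + 1/2) / t i)
                (q^(h i' - h i + 1) * t i' / t i)
                (q^(h i'' - h i + 1) * t i'' / t i) q.

Definition g_0 (x : C) : C :=
  xpow L x (lambda - alpha - 1)
  * (qpochs_inf [ q^(- lambda + h 1 + 3/2) * t 1 / x;
                  q^(- lambda + h 2 + 3/2) * t 2 / x;
                  q^(- lambda + h 3 + 3/2) * t 3 / x;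
                  q ] q
     / qpochs_inf [ q^(l 1 + 1/2) * t 1 / x;
                    q^(l 2 + 1/2) * t 2 / x;
                    q^(l 3 + 1/2) * t 3 / x;
                    q^(1 - lambda) ] q)
  * phi43 (q^(l 1 + 1/2) * t 1 / x)
          (q^(l 2 + 1/2) * t 2 / x)
          (q^(l 3 + 1/2) * t 3 / x)
          (q^(1 - lambda))
          (q^(- lambda + h 1 + 3/2) * t 1 / x)
          (q^(- lambda + h 2 + 3/2) * t 2 / x)
          (q^(- lambda + h 3 + 3/2) * t 3 / x)
          q q.

Definition g_0_defined (x : C) : Prop :=
  qpochs_inf [ q^(l 1 + 1/2) * t 1 / x;
               q^(l 2 + 1/2) * t 2 / x;
               q^(l 3 + 1/2) * t 3 / x;
               q^(1 - lambda) ] q <> 0 /\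
  phi43_defined (q^(- lambda + h 1 + 3/2) * t 1 / x)
                (q^(- lambda + h 2 + 3/2) * t 2 / x)
                (q^(- lambda + h 3 + 3/2) * t 3 / x) q.

End Equation.

(* Main.v *)
Require Import Defs.
From Stdlib Require Import Reals List Permutation Lra Lia.
From Coquelicot Require Import Coquelicot.
Import ListNotations.
Open Scope R_scope.
Open Scope C_scope.

(** The four functions are one and the same Jackson-type sum, started at
    different points, and the equation comes from a telescoping identity for
    its summand.

    Write P(y) for the infinite product (y; q)_oo, Q = q^lambda,
    a_j = q^(h_j + 1/2) t_j and b_j = q^(l_j - 1/2) t_j.  Absorbing the
    prefactor into the 4phi3 series turns each finite product (c; q)_n into a
    tail P(c q^n), and the function becomes
      g(x) = x^(lambda - alpha) (Q / q) Sum_n s_n K(x, s_n),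
      K(x, s) = P(Q x s) / P(x s) . Prod_j P(a_j s) / P(Q b_j s),
    where s_n = u q^n.  For the functions of part (i) the base point is
    u = q / a_i, independent of x; for part (ii) it is u = q / (Q x).

    After division by x^(lambda - alpha) q^alpha the coefficients of the
    equation are symmetric functions of the a_j and of the b_j, tied by the
    single relation a_1 a_2 a_3 = q^2 Q^2 b_1 b_2 b_3 ([roots_rel]), and the
    inhomogeneous term is (1 - Q) x^2.  Applied in x to (Q / q) s K(x, s), the
    homogeneous part of this reduced equation gives
      - (1 - Q) x^2 (W(x, q s) - W(x, s)),
      W(x, s) = P(Q x s) / P(x s / q) . Prod_j P(a_j s / q) / P(Q b_j s)
    ([kernel_telescopes]).  Since P(0) = 1 and P is continuous at 0, W(x, u q^n)
    tends to 1 and the sum is - (1 - Q) x^2 (1 - W(x, u))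
    ([telescoped_series]).

    In part (i), W(x, u) contains the factor P(a_i u / q) = P(1) = 0
    ([reduced_equation_fixed_base]).  In part (ii) the base point moves with
    x, so that the sum for q x starts one step earlier, and the one for x / q
    one step later, than the sum for x; telescoping is applied only from the
    first index present in all three, and the leftover terms add up to
    exactly the missing - (1 - Q) x^2 W(x, q u) ([boundary_terms],
    [reduced_equation_moving_base]).  Starting the telescoping at the earliest
    index, s = u / q, would need a division by P(1 / (q Q)), which vanishes for
    instance when Q = 1. *)

(** * Limits of complex sequences *)

(** Convergence phrased through the real sequence of distances, so that the
    squeeze lemmas for real limits apply. *)
Definition tends (u : nat -> C) (v : C) : Prop :=
  is_lim_seq (fun n => Cmod (u n - v)) 0%R.

Lemma tends_filterlim (u : nat -> C) (v : C) :
  tends u v <-> filterlim u eventually (locally (T := C_UniformSpace) v).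
Proof.
  unfold tends.
  rewrite (filterlim_locally_ball_norm (U := C_NormedModule) u v).
  rewrite <- is_lim_seq_spec.
  split; intros H eps; destruct (H eps) as [N HN]; exists N; intros n Hn;
    specialize (HN n Hn).
  - unfold ball_norm. change (Cmod (u n - v) < eps)%R.
    rewrite Rminus_0_r, Rabs_pos_eq in HN by apply Cmod_ge_0. exact HN.
  - rewrite Rminus_0_r, Rabs_pos_eq by apply Cmod_ge_0. exact HN.
Qed.

Lemma is_series_tends (a : nat -> C) (v : C) :
  is_series (V := C_NormedModule) a v
  <-> tends (sum_n (G := C_AbelianGroup) a) v.
Proof. symmetry. exact (tends_filterlim _ v). Qed.

Lemma tends_ext (u w : nat -> C) (v : C) :
  (forall n, u n = w n) -> tends u v -> tends w v.
Proof.
  intros E. apply is_lim_seq_ext. intros n. now rewrite E.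
Qed.

Lemma tends_const (v : C) : tends (fun _ => v) v.
Proof.
  apply is_lim_seq_ext with (fun _ => 0%R); [|apply is_lim_seq_const].
  intros _. unfold Cminus. now rewrite Cplus_opp_r, Cmod_0.
Qed.

Lemma tends_squeeze (u : nat -> C) (v : C) (b : nat -> R) :
  (forall n, (Cmod (u n - v) <= b n)%R) -> is_lim_seq b 0%R -> tends u v.
Proof.
  intros Hb H0.
  apply (is_lim_seq_le_le (fun _ => 0%R) _ b); trivial.
  - intros n. split; [apply Cmod_ge_0 | apply Hb].
  - apply is_lim_seq_const.
Qed.

Lemma tends_mult (u w : nat -> C) (a b : C) :
  tends u a -> tends w b -> tends (fun n => u n * w n) (a * b).
Proof.
  intros Hu Hw.
  apply tends_squeeze with (fun n =>
    (Cmod (u n - a) * Cmod (w n - b) + Cmod a * Cmod (w n - b)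
     + Cmod (u n - a) * Cmod b)%R).
  - intros n.
    replace (u n * w n - a * b)
      with ((u n - a) * (w n - b) + a * (w n - b) + (u n - a) * b) by ring.
    eapply Rle_trans; [apply Cmod_triangle|].
    rewrite Cmod_mult. apply Rplus_le_compat_r.
    eapply Rle_trans; [apply Cmod_triangle|].
    rewrite !Cmod_mult. apply Rle_refl.
  - replace 0%R with (0 * 0 + Cmod a * 0 + 0 * Cmod b)%R by ring.
    apply is_lim_seq_plus'; [apply is_lim_seq_plus'|];
      apply is_lim_seq_mult'; trivial; apply is_lim_seq_const.
Qed.

Lemma tends_minus_const (u : nat -> C) (a c : C) :
  tends u a -> tends (fun n => u n - c) (a - c).
Proof.
  apply is_lim_seq_ext. intros n. f_equal. ring.
Qed.

Lemma tends_unique (u : nat -> C) (a b : C) :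
  tends u a -> tends u b -> a = b.
Proof.
  intros Ha%tends_filterlim Hb%tends_filterlim.
  exact (filterlim_locally_unique (V := C_NormedModule) u a b Ha Hb).
Qed.

Lemma tends_shift (u : nat -> C) (v : C) (N : nat) :
  tends u v <-> tends (fun n => u (n + N)%nat) v.
Proof. apply is_lim_seq_incr_n with (N := N). Qed.

Lemma sum_n_telescope (w : nat -> C) (n : nat) :
  sum_n (G := C_AbelianGroup) (fun k => w (S k) - w k) n = w (S n) - w 0%nat.
Proof.
  induction n as [|n IH].
  - now rewrite sum_O.
  - rewrite sum_Sn, IH. change (w (S n) - w 0%nat + (w (S (S n)) - w (S n))
      = w (S (S n)) - w 0%nat). ring.
Qed.

Lemma is_series_telescope (w : nat -> C) (v : C) :
  tends w v ->
  is_series (V := C_NormedModule) (fun n => w (S n) - w n) (v - w 0%nat).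
Proof.
  intros H. apply is_series_tends.
  apply tends_ext with (fun n => w (S n) - w 0%nat).
  - intros n. now rewrite sum_n_telescope.
  - apply (tends_minus_const (fun n => w (S n))).
    apply (tends_shift _ _ 1) in H. revert H. apply tends_ext.
    intros n. now rewrite Nat.add_1_r.
Qed.

Definition bounded (u : nat -> C) : Prop :=
  exists M : R, forall n, (Cmod (u n) <= M)%R.

Lemma bounded_const (c : C) : bounded (fun _ => c).
Proof. exists (Cmod c). intros _. apply Rle_refl. Qed.

Lemma bounded_mult (u w : nat -> C) :
  bounded u -> bounded w -> bounded (fun n => u n * w n).
Proof.
  intros [M HM] [N HN]. exists (M * N)%R. intros n.
  rewrite Cmod_mult. apply Rmult_le_compat; auto using Cmod_ge_0.
Qed.

Lemma bounded_ext (u w : nat -> C) :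
  (forall n, u n = w n) -> bounded u -> bounded w.
Proof. intros E [M HM]. exists M. intros n. now rewrite <- E. Qed.

(** * Infinite q-products *)

Section QPochhammer.

Variable q : C.
Hypothesis hq : (0 < Cmod q < 1)%R.

Local Notation P y := (qpoch_inf y q).

Lemma q_neq0 : q <> 0.
Proof. apply Cmod_gt_0. lra. Qed.

Lemma ex_series_geom_bounded (u : nat -> C) :
  bounded u ->
  exists v, is_series (V := C_NormedModule) (fun n => q ^ n * u n) v.
Proof.
  intros [M HM].
  apply (ex_series_le (V := C_CompleteNormedModule) (fun n => q ^ n * u n)
           (fun n => (M * Cmod q ^ n)%R)).
  - intros n. change (Cmod (q ^ n * u n) <= M * Cmod q ^ n)%R.
    rewrite Cmod_mult, Cmod_pow, Rmult_comm.
    apply Rmult_le_compat_r; trivial. apply pow_le. lra.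
  - apply (ex_series_scal_l M (fun n => (Cmod q ^ n)%R)).
    apply ex_series_geom. rewrite Rabs_pos_eq; lra.
Qed.

(** The product of the bounds 1 + |a| |q|^k is controlled by
    1 + y <= exp y; the exponent is the geometric sum. *)
Lemma qpoch_le_exp (a : C) (n : nat) :
  (Cmod (qpoch a q n) <= exp (Cmod a * ((1 - Cmod q ^ n) / (1 - Cmod q))))%R.
Proof.
  induction n as [|n IH]; simpl qpoch.
  - rewrite Cmod_1. simpl. replace (Cmod a * _)%R with 0%R by (field; lra).
    rewrite exp_0. lra.
  - replace (Cmod a * ((1 - Cmod q ^ S n) / (1 - Cmod q)))%R
      with (Cmod a * ((1 - Cmod q ^ n) / (1 - Cmod q))
            + Cmod a * Cmod q ^ n)%R by (simpl; field; lra).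
    rewrite exp_plus, Cmod_mult.
    apply Rmult_le_compat; auto using Cmod_ge_0.
    apply Rle_trans with (1 + Cmod a * Cmod q ^ n)%R; [|apply exp_ineq1_le].
    eapply Rle_trans; [apply Cmod_triangle|].
    rewrite Cmod_opp, Cmod_mult, Cmod_pow, Cmod_1. lra.
Qed.

Lemma pow_q_range (n : nat) : (0 <= Cmod q ^ n <= 1)%R.
Proof.
  split; [apply pow_le; lra|].
  rewrite <- (pow1 n). apply pow_incr. lra.
Qed.

Lemma qpoch_le (a : C) (n : nat) :
  (Cmod (qpoch a q n) <= exp (Cmod a / (1 - Cmod q)))%R.
Proof.
  eapply Rle_trans; [apply qpoch_le_exp|].
  destruct (Req_dec (Cmod a * ((1 - Cmod q ^ n) / (1 - Cmod q)))
              (Cmod a / (1 - Cmod q))) as [->|Hne]; [lra|].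
  apply Rlt_le, exp_increasing.
  assert (H : (Cmod a * ((1 - Cmod q ^ n) / (1 - Cmod q))
               <= Cmod a / (1 - Cmod q))%R); [|lra].
  apply Rmult_le_compat_l; [apply Cmod_ge_0|].
  pose proof (pow_q_range n).
  apply Rle_trans with (1 * / (1 - Cmod q))%R; [|lra].
  apply Rmult_le_compat_r; [|lra].
  apply Rlt_le, Rinv_0_lt_compat. lra.
Qed.

Lemma qpoch_bounded (a : C) : bounded (qpoch a q).
Proof. eexists. apply qpoch_le. Qed.

Lemma qpoch_sub1_le (a : C) (n : nat) :
  (Cmod (qpoch a q n - 1)
   <= Cmod a * exp (Cmod a / (1 - Cmod q)) * ((1 - Cmod q ^ n) / (1 - Cmod q)))%R.
Proof.
  induction n as [|n IH]; simpl qpoch.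
  - replace (1 - 1) with (RtoC 0) by ring. rewrite Cmod_0. simpl. right.
    field. lra.
  - replace (qpoch a q n * (1 - a * q ^ n) - 1)
      with ((qpoch a q n - 1) + - (a * q ^ n * qpoch a q n)) by ring.
    eapply Rle_trans; [apply Cmod_triangle|].
    rewrite Cmod_opp, !Cmod_mult, Cmod_pow.
    replace (Cmod a * exp (Cmod a / (1 - Cmod q)) *
             ((1 - Cmod q ^ S n) / (1 - Cmod q)))%R
      with (Cmod a * exp (Cmod a / (1 - Cmod q)) *
              ((1 - Cmod q ^ n) / (1 - Cmod q))
            + Cmod a * Cmod q ^ n * exp (Cmod a / (1 - Cmod q)))%R
      by (simpl; field; lra).
    apply Rplus_le_compat; trivial.
    apply Rmult_le_compat_l; [|apply qpoch_le].
    apply Rmult_le_pos; [apply Cmod_ge_0|apply pow_q_range].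
Qed.

(** The partial products are 1 plus the partial sums of their increments
    - a q^n (a; q)_n, which are dominated by a geometric series. *)
Lemma qpoch_tends (a : C) : tends (qpoch a q) (P a).
Proof.
  assert (H : exists v, tends (qpoch a q) v).
  { destruct (ex_series_geom_bounded (fun n => (- a) * qpoch a q n)) as [v Hv].
    - apply bounded_mult; [apply bounded_const|apply qpoch_bounded].
    - exists (v - (- (1))). apply (tends_shift _ _ 1).
      apply is_series_tends, (tends_minus_const _ _ (- (1))) in Hv.
      revert Hv. apply tends_ext. intros n. rewrite Nat.add_1_r.
      rewrite (sum_n_ext _ (fun k => qpoch a q (S k) - qpoch a q k)).
      + rewrite sum_n_telescope. simpl. ring.
      + intros k. simpl. ring. }
  destruct H as [v Hv].
  replace (P a) with v; trivial.
  symmetry. apply CLim_seq_unique, tends_filterlim, Hv.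
Qed.

(** Continuity of the infinite product at 0, with an explicit modulus. *)
Lemma qpoch_inf_sub1_le (a : C) :
  (Cmod (P a - 1)
   <= Cmod a * exp (Cmod a / (1 - Cmod q)) * / (1 - Cmod q))%R.
Proof.
  set (K := (Cmod a * exp (Cmod a / (1 - Cmod q)))%R).
  assert (HK : (0 <= K)%R).
  { apply Rmult_le_pos; [apply Cmod_ge_0|apply Rlt_le, exp_pos]. }
  assert (Hi : (0 < / (1 - Cmod q))%R) by (apply Rinv_0_lt_compat; lra).
  apply (is_lim_seq_le (fun _ => Cmod (P a - 1))
           (fun n => Cmod (qpoch a q n - P a) + K * / (1 - Cmod q))%R
           (Cmod (P a - 1)) (K * / (1 - Cmod q))%R).
  - intros n.
    replace (P a - 1) with (- (qpoch a q n - P a) + (qpoch a q n - 1)) by ring.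
    eapply Rle_trans; [apply Cmod_triangle|].
    rewrite Cmod_opp. apply Rplus_le_compat_l.
    eapply Rle_trans; [apply qpoch_sub1_le|]. fold K.
    apply Rmult_le_compat_l; trivial.
    rewrite <- (Rmult_1_l (/ (1 - Cmod q))%R).
    apply Rmult_le_compat_r; [lra|]. pose proof (pow_q_range n). lra.
  - apply is_lim_seq_const.
  - rewrite <- (Rplus_0_l (K * / (1 - Cmod q))%R) at 1.
    apply is_lim_seq_plus'; [apply qpoch_tends|apply is_lim_seq_const].
Qed.

Lemma qpoch_inf_tail_tends (a : C) : tends (fun n => P (a * q ^ n)) 1.
Proof.
  apply tends_squeeze with (fun n =>
    (Cmod a * exp (Cmod a / (1 - Cmod q)) * / (1 - Cmod q) * Cmod q ^ n)%R).
  - intros n. eapply Rle_trans; [apply qpoch_inf_sub1_le|].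
    assert (Hi : (0 < / (1 - Cmod q))%R) by (apply Rinv_0_lt_compat; lra).
    pose proof (pow_q_range n) as Hr. pose proof (Cmod_ge_0 a) as Ha.
    replace (Cmod a * exp (Cmod a / (1 - Cmod q)) * / (1 - Cmod q) * Cmod q ^ n)%R
      with (Cmod a * Cmod q ^ n * exp (Cmod a / (1 - Cmod q)) * / (1 - Cmod q))%R
      by ring.
    rewrite Cmod_mult, Cmod_pow.
    apply Rmult_le_compat_r; [lra|].
    apply Rmult_le_compat_l; [apply Rmult_le_pos; lra|].
    destruct (Req_dec (Cmod a * Cmod q ^ n) (Cmod a)) as [->|Hne]; [lra|].
    apply Rlt_le, exp_increasing. apply Rmult_lt_compat_r; trivial.
    assert (Cmod a * Cmod q ^ n <= Cmod a * 1)%R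
      by (apply Rmult_le_compat_l; lra). lra.
  - rewrite <- (Rmult_0_r (Cmod a * exp (Cmod a / (1 - Cmod q)) * / (1 - Cmod q))%R).
    apply is_lim_seq_mult'; [apply is_lim_seq_const|].
    apply is_lim_seq_geom. rewrite Rabs_pos_eq; lra.
Qed.

Lemma qpoch_add (a : C) (n m : nat) :
  qpoch a q (n + m) = qpoch a q n * qpoch (a * q ^ n) q m.
Proof.
  induction m as [|m IH].
  - rewrite Nat.add_0_r. simpl. ring.
  - rewrite Nat.add_succ_r. simpl. rewrite IH, Cpow_add_r. ring.
Qed.

Lemma qpoch_inf_split (a : C) (n : nat) :
  P a = qpoch a q n * P (a * q ^ n).
Proof.
  apply tends_unique with (fun m => qpoch a q (m + n)).
  - apply (tends_shift (qpoch a q)), qpoch_tends.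
  - apply tends_ext with (fun m => qpoch a q n * qpoch (a * q ^ n) q m).
    + intros m. now rewrite <- qpoch_add, Nat.add_comm.
    + apply tends_mult; [apply tends_const|apply qpoch_tends].
Qed.

Lemma qpoch_inf_shift (a : C) : P a = (1 - a) * P (q * a).
Proof.
  rewrite (qpoch_inf_split a 1). simpl.
  replace (a * (q * 1)) with (q * a) by ring. ring.
Qed.

Lemma qpoch_inf_1 : P 1 = 0.
Proof. rewrite qpoch_inf_shift. ring. Qed.

Lemma Cmult_neq0_l (a b : C) : a * b <> 0 -> a <> 0.
Proof. intros H ->. apply H. ring. Qed.

Lemma Cmult_neq0_r (a b : C) : a * b <> 0 -> b <> 0.
Proof. intros H ->. apply H. ring. Qed.

Lemma qpoch_inf_tail_neq0 (a : C) (n : nat) : P a <> 0 -> P (a * q ^ n) <> 0.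
Proof. rewrite (qpoch_inf_split a n). apply Cmult_neq0_r. Qed.

Lemma qpoch_neq0 (a : C) (n : nat) : P a <> 0 -> qpoch a q n <> 0.
Proof. rewrite (qpoch_inf_split a n). apply Cmult_neq0_l. Qed.

(** An infinite product vanishes only through one of its factors, because its
    tails tend to 1. *)
Lemma qpoch_inf_neq0 (a : C) : (forall n, qpoch a q n <> 0) -> P a <> 0.
Proof.
  intros H.
  pose proof (qpoch_inf_tail_tends a) as T.
  apply is_lim_seq_spec in T. destruct (T (mkposreal 1 Rlt_0_1)) as [N HN].
  specialize (HN N (Nat.le_refl N)). simpl in HN.
  rewrite (qpoch_inf_split a N). apply Cmult_neq_0; trivial.
  intros E. rewrite E in HN.
  replace (0 - 1) with (- (1)) in HN by ring.
  rewrite Cmod_m1, Rminus_0_r, Rabs_pos_eq in HN; lra.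
Qed.

(** Reciprocals of tails are multiples of partial products, so that their
    limits need no continuity of the inverse. *)
Lemma qpoch_inf_tail_inv (a : C) (n : nat) :
  P a <> 0 -> / P (a * q ^ n) = / P a * qpoch a q n.
Proof.
  intros H. pose proof (qpoch_neq0 a n H). pose proof (qpoch_inf_tail_neq0 a n H).
  rewrite (qpoch_inf_split a n) at 1. field. now split.
Qed.

Lemma qpoch_inf_tail_inv_tends (a : C) :
  P a <> 0 -> tends (fun n => / P (a * q ^ n)) 1.
Proof.
  intros H. apply tends_ext with (fun n => / P a * qpoch a q n).
  - intros n. now rewrite qpoch_inf_tail_inv.
  - replace (RtoC 1) with (/ P a * P a) by (field; trivial).
    apply tends_mult; [apply tends_const|apply qpoch_tends].
Qed.

Lemma tends_bounded (u : nat -> C) (v : C) : tends u v -> bounded u.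
Proof.
  intros H%tends_filterlim.
  destruct (filterlim_bounded (V := C_NormedModule) u (ex_intro _ v H))
    as [M HM].
  now exists M.
Qed.

(** Multiplying the series by the quotient of infinite products replaces every
    partial product by a tail; this is the form in which the summand depends
    on n only through the point s = u q^n. *)
Lemma phi43_series (a1 a2 a3 a4 c1 c2 c3 : C) :
  qpochs_inf [a1; a2; a3; a4] q <> 0 ->
  phi43_defined c1 c2 c3 q ->
  is_series (V := C_NormedModule)
    (fun n => q ^ n *
       (P (c1 * q ^ n) * P (c2 * q ^ n) * P (c3 * q ^ n) * P (q * q ^ n)
        / (P (a1 * q ^ n) * P (a2 * q ^ n) * P (a3 * q ^ n) * P (a4 * q ^ n))))
    (qpochs_inf [c1; c2; c3; q] q / qpochs_inf [a1; a2; a3; a4] q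
     * phi43 a1 a2 a3 a4 c1 c2 c3 q q).
Proof.
  unfold qpochs_inf, phi43_defined. simpl. intros Ha Hc.
  assert (Ha1 : P a1 <> 0) by (intros E; apply Ha; rewrite E; ring).
  assert (Ha2 : P a2 <> 0) by (intros E; apply Ha; rewrite E; ring).
  assert (Ha3 : P a3 <> 0) by (intros E; apply Ha; rewrite E; ring).
  assert (Ha4 : P a4 <> 0) by (intros E; apply Ha; rewrite E; ring).
  assert (Hq : forall n, qpoch q q n <> 0)
    by (intros n E; apply (Hc n); rewrite E; ring).
  assert (Hc1 : forall n, qpoch c1 q n <> 0)
    by (intros n E; apply (Hc n); rewrite E; ring).
  assert (Hc2 : forall n, qpoch c2 q n <> 0)
    by (intros n E; apply (Hc n); rewrite E; ring).
  assert (Hc3 : forall n, qpoch c3 q n <> 0)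
    by (intros n E; apply (Hc n); rewrite E; ring).
  set (r := fun n =>
    (qpoch a1 q n * qpoch a2 q n * qpoch a3 q n * qpoch a4 q n)
    / (qpoch q q n * qpoch c1 q n * qpoch c2 q n * qpoch c3 q n)).
  assert (Hinv : forall c n, (forall m, qpoch c q m <> 0) ->
            / qpoch c q n = / P c * P (c * q ^ n)).
  { intros c n H. pose proof (qpoch_inf_neq0 c H) as Hn.
    pose proof (qpoch_inf_tail_neq0 c n Hn). specialize (H n).
    rewrite (qpoch_inf_split c n) at 1. field. now split. }
  assert (Hbd : forall c, (forall m, qpoch c q m <> 0) ->
            bounded (fun n => / qpoch c q n)).
  { intros c H. apply bounded_ext with (fun n => / P c * P (c * q ^ n)).
    - intros n. now rewrite Hinv.
    - apply bounded_mult; [apply bounded_const|].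
      eapply tends_bounded, qpoch_inf_tail_tends. }
  assert (Hr : bounded r).
  { apply bounded_ext with (fun n =>
      (qpoch a1 q n * qpoch a2 q n * qpoch a3 q n * qpoch a4 q n)
      * (/ qpoch q q n * / qpoch c1 q n * / qpoch c2 q n * / qpoch c3 q n)).
    - intros n. unfold r. field. auto.
    - repeat first [ apply bounded_mult | apply qpoch_bounded | apply Hbd ];
        trivial. }
  destruct (ex_series_geom_bounded r Hr) as [v Hv].
  replace (phi43 a1 a2 a3 a4 c1 c2 c3 q q) with v.
  2: { symmetry. apply CSeries_unique. revert Hv. apply is_series_ext.
       intros n. unfold r. apply Cmult_comm. }
  set (K := P c1 * _ / _).
  apply (is_series_scal (V := C_NormedModule) K) in Hv.
  revert Hv. apply is_series_ext. intros n.
  change (K * (q ^ n * r n) = q ^ n *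
    (P (c1 * q ^ n) * P (c2 * q ^ n) * P (c3 * q ^ n) * P (q * q ^ n)
     / (P (a1 * q ^ n) * P (a2 * q ^ n) * P (a3 * q ^ n) * P (a4 * q ^ n)))).
  unfold K, r.
  rewrite (qpoch_inf_split c1 n), (qpoch_inf_split c2 n),
    (qpoch_inf_split c3 n), (qpoch_inf_split q n),
    (qpoch_inf_split a1 n), (qpoch_inf_split a2 n),
    (qpoch_inf_split a3 n), (qpoch_inf_split a4 n).
  field.
  repeat split; trivial; auto using qpoch_neq0, qpoch_inf_tail_neq0.
Qed.

(** * The telescoping identity *)

Section Telescoping.

Variables (Q a1 a2 a3 b1 b2 b3 : C).
Hypothesis rel : a1 * a2 * a3 = q ^ 2 * Q ^ 2 * (b1 * b2 * b3).
Hypothesis HQ : Q <> 0.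

Definition kernel (x s : C) : C :=
  P (Q * x * s) * P (a1 * s) * P (a2 * s) * P (a3 * s)
  / (P (x * s) * P (Q * b1 * s) * P (Q * b2 * s) * P (Q * b3 * s)).

(** The quantity whose increments along s, q s, q^2 s give the equation. *)
Definition flux (x s : C) : C :=
  P (Q * x * s) * P (a1 * s / q) * P (a2 * s / q) * P (a3 * s / q)
  / (P (x * s / q) * P (Q * b1 * s) * P (Q * b2 * s) * P (Q * b3 * s)).

(** The coefficient of g(x) divided by q^alpha, in terms of the roots of the
    two outer coefficients. *)
Definition reduced_mid (x : C) : C :=
  - (q + 1) * x ^ 3 + ((a1 + a2 + a3) + q * (b1 + b2 + b3)) * x ^ 2
  - ((a2 * a3 + a1 * a3 + a1 * a2) / Q
     + q * Q * (b2 * b3 + b1 * b3 + b1 * b2)) * x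
  + q * (q + 1) * Q * (b1 * b2 * b3).

(** The homogeneous part of the equation for the function
    x^(alpha - lambda) g(x), divided by q^alpha x^(lambda - alpha): the shifts
    of x^(lambda - alpha) supply the factors 1 / Q and Q. *)
Definition reduced_op (x gdown gmid gup : C) : C :=
  / Q * ((x - a1) * (x - a2) * (x - a3)) * gdown
  + q * Q * ((x - b1) * (x - b2) * (x - b3)) * gup
  + reduced_mid x * gmid.

Lemma qpoch_inf_step (y z : C) : q * y = z -> P y = (1 - y) * P z.
Proof. intros <-. apply qpoch_inf_shift. Qed.


(** A common factor of the values of the kernel at x / q, x and q x, and of
    the flux at s and q s: dividing by it leaves rational functions, so that
    the telescoping identity becomes one between polynomials.  The denominator
    has P(x s) and not P(x s / q), which may vanish at the base point of the
    moving sum. *)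
Definition pivot (x s : C) : C :=
  P (q * (Q * x * s)) * P (a1 * s) * P (a2 * s) * P (a3 * s)
  / (P (x * s) * P (Q * b1 * s) * P (Q * b2 * s) * P (Q * b3 * s)).

Lemma kernel_pivot (x s : C) : kernel x s = (1 - Q * x * s) * pivot x s.
Proof.
  unfold kernel, pivot, Cdiv. rewrite (qpoch_inf_shift (Q * x * s)). ring.
Qed.

Lemma kernel_up_pivot (x s : C) :
  P (x * s) <> 0 ->
  P (Q * b1 * s) <> 0 -> P (Q * b2 * s) <> 0 -> P (Q * b3 * s) <> 0 ->
  kernel (q * x) s = (1 - x * s) * pivot x s.
Proof.
  intros Hx H1 H2 H3. unfold kernel, pivot.
  replace (Q * (q * x) * s) with (q * (Q * x * s)) by ring.
  replace (q * x * s) with (q * (x * s)) by ring.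
  rewrite (qpoch_inf_shift (x * s)) in Hx |- *.
  field. repeat split; trivial; eauto using Cmult_neq0_l, Cmult_neq0_r.
Qed.

Lemma kernel_down_pivot (x s : C) :
  P (x * s / q) <> 0 ->
  P (Q * b1 * s) <> 0 -> P (Q * b2 * s) <> 0 -> P (Q * b3 * s) <> 0 ->
  (1 - x * s / q) * kernel (x / q) s
  = (1 - Q * x * s) * (1 - Q * x * s / q) * pivot x s.
Proof.
  intros Hx H1 H2 H3. pose proof q_neq0 as Hq. unfold kernel, pivot.
  replace (Q * (x / q) * s) with (Q * x * s / q) by (field; trivial).
  replace (x / q * s) with (x * s / q) by (field; trivial).
  rewrite (qpoch_inf_step (x * s / q) (x * s)) in Hx |- * by (field; trivial).
  rewrite (qpoch_inf_step (Q * x * s / q) (Q * x * s)) by (field; trivial).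
  rewrite (qpoch_inf_shift (Q * x * s)).
  generalize (Cmult_neq0_l _ _ Hx). generalize (x * s / q). intros y Hy.
  field. repeat split; trivial; eauto using Cmult_neq0_l, Cmult_neq0_r.
Qed.

Lemma flux_pivot (x s : C) :
  P (x * s / q) <> 0 ->
  P (Q * b1 * s) <> 0 -> P (Q * b2 * s) <> 0 -> P (Q * b3 * s) <> 0 ->
  (1 - x * s / q) * flux x s
  = (1 - a1 * s / q) * (1 - a2 * s / q) * (1 - a3 * s / q)
    * (1 - Q * x * s) * pivot x s.
Proof.
  intros Hx H1 H2 H3. pose proof q_neq0 as Hq. unfold flux, pivot.
  rewrite (qpoch_inf_step (x * s / q) (x * s)) in Hx |- * by (field; trivial).
  rewrite (qpoch_inf_step (a1 * s / q) (a1 * s)) by (field; trivial).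
  rewrite (qpoch_inf_step (a2 * s / q) (a2 * s)) by (field; trivial).
  rewrite (qpoch_inf_step (a3 * s / q) (a3 * s)) by (field; trivial).
  rewrite (qpoch_inf_shift (Q * x * s)).
  generalize (Cmult_neq0_l _ _ Hx).
  generalize (x * s / q) (a1 * s / q) (a2 * s / q) (a3 * s / q).
  intros y y1 y2 y3 Hy.
  field. repeat split; trivial; eauto using Cmult_neq0_l, Cmult_neq0_r.
Qed.

Lemma flux_up_pivot (x s : C) :
  P (x * s) <> 0 ->
  P (Q * b1 * s) <> 0 -> P (Q * b2 * s) <> 0 -> P (Q * b3 * s) <> 0 ->
  flux x (q * s)
  = (1 - Q * b1 * s) * (1 - Q * b2 * s) * (1 - Q * b3 * s) * pivot x s.
Proof.
  intros Hx H1 H2 H3. pose proof q_neq0 as Hq. unfold flux, pivot.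
  replace (x * (q * s) / q) with (x * s) by (field; trivial).
  replace (a1 * (q * s) / q) with (a1 * s) by (field; trivial).
  replace (a2 * (q * s) / q) with (a2 * s) by (field; trivial).
  replace (a3 * (q * s) / q) with (a3 * s) by (field; trivial).
  replace (Q * x * (q * s)) with (q * (Q * x * s)) by ring.
  replace (Q * b1 * (q * s)) with (q * (Q * b1 * s)) by ring.
  replace (Q * b2 * (q * s)) with (q * (Q * b2 * s)) by ring.
  replace (Q * b3 * (q * s)) with (q * (Q * b3 * s)) by ring.
  rewrite (qpoch_inf_shift (Q * b1 * s)) in H1 |- *.
  rewrite (qpoch_inf_shift (Q * b2 * s)) in H2 |- *.
  rewrite (qpoch_inf_shift (Q * b3 * s)) in H3 |- *.
  field. repeat split; trivial; eauto using Cmult_neq0_l, Cmult_neq0_r.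
Qed.

(** In the moving sum the series for q x has one term more at the start; its
    point is s / q. *)
Lemma kernel_up_prev_pivot (x s : C) :
  P (x * s) <> 0 ->
  P (Q * b1 * s / q) <> 0 -> P (Q * b2 * s / q) <> 0 ->
  P (Q * b3 * s / q) <> 0 ->
  (1 - Q * b1 * s / q) * (1 - Q * b2 * s / q) * (1 - Q * b3 * s / q)
    * kernel (q * x) (s / q)
  = (1 - Q * x * s)
    * ((1 - a1 * s / q) * (1 - a2 * s / q) * (1 - a3 * s / q)) * pivot x s.
Proof.
  intros Hx H1 H2 H3. pose proof q_neq0 as Hq. unfold kernel, pivot.
  replace (Q * (q * x) * (s / q)) with (Q * x * s) by (field; trivial).
  replace (q * x * (s / q)) with (x * s) by (field; trivial).
  replace (a1 * (s / q)) with (a1 * s / q) by (field; trivial).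
  replace (a2 * (s / q)) with (a2 * s / q) by (field; trivial).
  replace (a3 * (s / q)) with (a3 * s / q) by (field; trivial).
  replace (Q * b1 * (s / q)) with (Q * b1 * s / q) by (field; trivial).
  replace (Q * b2 * (s / q)) with (Q * b2 * s / q) by (field; trivial).
  replace (Q * b3 * (s / q)) with (Q * b3 * s / q) by (field; trivial).
  rewrite (qpoch_inf_step (a1 * s / q) (a1 * s)) by (field; trivial).
  rewrite (qpoch_inf_step (a2 * s / q) (a2 * s)) by (field; trivial).
  rewrite (qpoch_inf_step (a3 * s / q) (a3 * s)) by (field; trivial).
  rewrite (qpoch_inf_shift (Q * x * s)).
  rewrite (qpoch_inf_step (Q * b1 * s / q) (Q * b1 * s)) in H1 |- *
    by (field; trivial).
  rewrite (qpoch_inf_step (Q * b2 * s / q) (Q * b2 * s)) in H2 |- *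
    by (field; trivial).
  rewrite (qpoch_inf_step (Q * b3 * s / q) (Q * b3 * s)) in H3 |- *
    by (field; trivial).
  generalize (Cmult_neq0_l _ _ H1) (Cmult_neq0_l _ _ H2) (Cmult_neq0_l _ _ H3).
  generalize (a1 * s / q) (a2 * s / q) (a3 * s / q).
  generalize (Q * b1 * s / q) (Q * b2 * s / q) (Q * b3 * s / q).
  intros z1 z2 z3 y1 y2 y3 Hz1 Hz2 Hz3.
  field. repeat split; trivial; eauto using Cmult_neq0_l, Cmult_neq0_r.
Qed.

(** Divided by the pivot and multiplied by 1 - x s / q, both sides are
    polynomials in s with terms in s, s^2 and s^3 only: the constant terms of the two fluxes cancel, and
    the terms in s^4 cancel by the relation between the roots. *)
Lemma kernel_telescopes (x s : C) :
  P (x * s / q) <> 0 ->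
  P (Q * b1 * s) <> 0 -> P (Q * b2 * s) <> 0 -> P (Q * b3 * s) <> 0 ->
  s * Q / q * reduced_op x (kernel (x / q) s) (kernel x s) (kernel (q * x) s)
  = - (1 - Q) * x ^ 2 * (flux x (q * s) - flux x s).
Proof.
  intros Hx H1 H2 H3. pose proof q_neq0 as Hq.
  pose proof Hx as Hx'.
  rewrite (qpoch_inf_step (x * s / q) (x * s)) in Hx' by (field; trivial).
  pose proof (Cmult_neq0_l _ _ Hx') as Hy.
  apply Cmult_neq0_r in Hx'.
  pose proof (kernel_down_pivot x s Hx H1 H2 H3) as Ed.
  pose proof (flux_pivot x s Hx H1 H2 H3) as Ef.
  rewrite kernel_up_pivot, (kernel_pivot x s), flux_up_pivot by trivial.
  assert (Ed' : kernel (x / q) s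
    = (1 - Q * x * s) * (1 - Q * x * s / q) * pivot x s / (1 - x * s / q)).
  { rewrite <- Ed. revert Hy. generalize (x * s / q). intros y Hy.
    field. trivial. }
  assert (Ef' : flux x s
    = (1 - a1 * s / q) * (1 - a2 * s / q) * (1 - a3 * s / q)
      * (1 - Q * x * s) * pivot x s / (1 - x * s / q)).
  { rewrite <- Ef. revert Hy. generalize (x * s / q). intros y Hy.
    field. trivial. }
  rewrite Ed', Ef'. unfold reduced_op, reduced_mid.
  field [rel]. repeat split; trivial.
  intros E. apply Hy. replace (1 - x * s / q) with ((q - x * s) / q)
    by (field; trivial). rewrite E. field; trivial.
Qed.

Lemma is_series_tail (a : nat -> C) (v : C) :
  is_series (V := C_NormedModule) a v ->
  is_series (V := C_NormedModule) (fun n => a (S n)) (v - a 0%nat).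
Proof.
  intros H. apply is_series_incr_1.
  change (is_series (V := C_NormedModule) a (v - a 0%nat + a 0%nat)).
  now replace (v - a 0%nat + a 0%nat) with v by ring.
Qed.

Lemma is_series_reduced_op (x k : C) (d m u : nat -> C) (vd vm vu : C) :
  is_series (V := C_NormedModule) d vd ->
  is_series (V := C_NormedModule) m vm ->
  is_series (V := C_NormedModule) u vu ->
  is_series (V := C_NormedModule)
    (fun n => k * reduced_op x (d n) (m n) (u n))
    (k * reduced_op x vd vm vu).
Proof.
  intros Hd Hm Hu. unfold reduced_op.
  apply (is_series_scal (V := C_NormedModule)
           (k * (/ Q * ((x - a1) * (x - a2) * (x - a3))))) in Hd.
  apply (is_series_scal (V := C_NormedModule)
           (k * (q * Q * ((x - b1) * (x - b2) * (x - b3))))) in Hu.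
  apply (is_series_scal (V := C_NormedModule) (k * reduced_mid x)) in Hm.
  pose proof (is_series_plus _ _ _ _ (is_series_plus _ _ _ _ Hd Hu) Hm) as H.
  match type of H with is_series _ ?w =>
    replace w with (k * (/ Q * ((x - a1) * (x - a2) * (x - a3)) * vd
      + q * Q * ((x - b1) * (x - b2) * (x - b3)) * vu
      + reduced_mid x * vm)) in H
  end.
  - revert H. apply is_series_ext. intros n.
    change (k * (/ Q * ((x - a1) * (x - a2) * (x - a3))) * d n
      + k * (q * Q * ((x - b1) * (x - b2) * (x - b3))) * u n
      + k * reduced_mid x * m n
      = k * (/ Q * ((x - a1) * (x - a2) * (x - a3)) * d n
      + q * Q * ((x - b1) * (x - b2) * (x - b3)) * u n
      + reduced_mid x * m n)).
    ring.
  - change (k * (/ Q * ((x - a1) * (x - a2) * (x - a3)) * vd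
      + q * Q * ((x - b1) * (x - b2) * (x - b3)) * vu
      + reduced_mid x * vm) =
      k * (/ Q * ((x - a1) * (x - a2) * (x - a3))) * vd
      + k * (q * Q * ((x - b1) * (x - b2) * (x - b3))) * vu
      + k * reduced_mid x * vm).
    ring.
Qed.

Lemma is_series_unique_C (a : nat -> C) (v w : C) :
  is_series (V := C_NormedModule) a v ->
  is_series (V := C_NormedModule) a w -> v = w.
Proof. rewrite !is_series_tends. apply tends_unique. Qed.

Lemma flux_tends (x u : C) :
  P (x * u / q) <> 0 ->
  P (Q * b1 * u) <> 0 -> P (Q * b2 * u) <> 0 -> P (Q * b3 * u) <> 0 ->
  tends (fun n => flux x (u * q ^ n)) 1.
Proof.
  intros Hx H1 H2 H3. pose proof q_neq0 as Hq.
  apply tends_ext with (fun n =>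
    P (Q * x * u * q ^ n) * P (a1 * u / q * q ^ n)
    * P (a2 * u / q * q ^ n) * P (a3 * u / q * q ^ n)
    * (/ P (x * u / q * q ^ n) * / P (Q * b1 * u * q ^ n)
       * / P (Q * b2 * u * q ^ n) * / P (Q * b3 * u * q ^ n))).
  - intros n. unfold flux.
    replace (x * (u * q ^ n) / q) with (x * u / q * q ^ n) by (field; trivial).
    replace (a1 * (u * q ^ n) / q) with (a1 * u / q * q ^ n) by (field; trivial).
    replace (a2 * (u * q ^ n) / q) with (a2 * u / q * q ^ n) by (field; trivial).
    replace (a3 * (u * q ^ n) / q) with (a3 * u / q * q ^ n) by (field; trivial).
    rewrite !Cmult_assoc.
    field. repeat split; apply qpoch_inf_tail_neq0; trivial.
  - replace (RtoC 1) with (1 * 1 * 1 * 1 * (1 * 1 * 1 * 1)) by ring.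
    repeat first [ apply tends_mult | apply qpoch_inf_tail_tends
                 | apply qpoch_inf_tail_inv_tends ]; trivial.
Qed.

Lemma telescoped_series (x u vd vm vu : C) :
  P (x * u / q) <> 0 ->
  P (Q * b1 * u) <> 0 -> P (Q * b2 * u) <> 0 -> P (Q * b3 * u) <> 0 ->
  is_series (V := C_NormedModule)
    (fun n => q ^ n * kernel (x / q) (u * q ^ n)) vd ->
  is_series (V := C_NormedModule)
    (fun n => q ^ n * kernel x (u * q ^ n)) vm ->
  is_series (V := C_NormedModule)
    (fun n => q ^ n * kernel (q * x) (u * q ^ n)) vu ->
  u * Q / q * reduced_op x vd vm vu = - (1 - Q) * x ^ 2 * (1 - flux x u).
Proof.
  intros Hx H1 H2 H3 Hd Hm Hu. pose proof q_neq0 as Hq.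
  set (k := - (1 - Q) * x ^ 2).
  pose proof (is_series_telescope _ _ (flux_tends x u Hx H1 H2 H3)) as Hf.
  apply (is_series_scal (V := C_NormedModule) k) in Hf. cbv beta in Hf.
  change (q ^ 0) with (RtoC 1) in Hf. rewrite Cmult_1_r in Hf.
  apply (is_series_unique_C
    (fun n => u * Q / q * reduced_op x (q ^ n * kernel (x / q) (u * q ^ n))
       (q ^ n * kernel x (u * q ^ n)) (q ^ n * kernel (q * x) (u * q ^ n)))).
  - now apply is_series_reduced_op.
  - revert Hf. apply is_series_ext. intros n.
    change (k * (flux x (u * q ^ S n) - flux x (u * q ^ n)) =
      u * Q / q * reduced_op x (q ^ n * kernel (x / q) (u * q ^ n))
       (q ^ n * kernel x (u * q ^ n)) (q ^ n * kernel (q * x) (u * q ^ n))).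
    rewrite Cpow_S. replace (u * (q * q ^ n)) with (q * (u * q ^ n)) by ring.
    unfold k. rewrite <- kernel_telescopes.
    + unfold reduced_op. field. now split.
    + replace (x * (u * q ^ n) / q) with (x * u / q * q ^ n) by (field; trivial).
      now apply qpoch_inf_tail_neq0.
    + rewrite Cmult_assoc. now apply qpoch_inf_tail_neq0.
    + rewrite Cmult_assoc. now apply qpoch_inf_tail_neq0.
    + rewrite Cmult_assoc. now apply qpoch_inf_tail_neq0.
Qed.

(** The terms lost when the telescoping starts one step after u: index 0 for
    x, indices 0 and 1 for q x, and none for x / q.  They make up for the value
    of the flux at the new starting point. *)
Lemma boundary_terms (x u : C) :
  x <> 0 -> Q * x * u = q ->
  P (x * u) <> 0 ->
  P (Q * b1 * u / q) <> 0 -> P (Q * b2 * u / q) <> 0 ->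
  P (Q * b3 * u / q) <> 0 ->
  u * Q / q * reduced_op x 0 (kernel x u)
    (kernel (q * x) (u / q) / q + kernel (q * x) u)
  = - (1 - Q) * x ^ 2 * flux x (q * u).
Proof.
  intros Hx0 Hu Hx H1 H2 H3. pose proof q_neq0 as Hq.
  assert (Eu : u = q / (Q * x)) by (rewrite <- Hu; field; now split).
  pose proof (kernel_up_prev_pivot x u Hx H1 H2 H3) as Ep.
  rewrite (qpoch_inf_step (Q * b1 * u / q) (Q * b1 * u)) in H1
    by (field; trivial).
  rewrite (qpoch_inf_step (Q * b2 * u / q) (Q * b2 * u)) in H2
    by (field; trivial).
  rewrite (qpoch_inf_step (Q * b3 * u / q) (Q * b3 * u)) in H3
    by (field; trivial).
  rewrite (kernel_up_pivot x u), (kernel_pivot x u), flux_up_pivot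
    by eauto using Cmult_neq0_r.
  apply Cmult_neq0_l in H1, H2, H3.
  replace (Q * b1 * u / q) with (b1 / x) in *
    by (rewrite Eu; field; repeat split; trivial).
  replace (Q * b2 * u / q) with (b2 / x) in *
    by (rewrite Eu; field; repeat split; trivial).
  replace (Q * b3 * u / q) with (b3 / x) in *
    by (rewrite Eu; field; repeat split; trivial).
  unfold reduced_op.
  (* x - b_j is x times the factor 1 - Q b_j u / q that separates the first
     term for q x from the pivot. *)
  replace (q * Q * ((x - b1) * (x - b2) * (x - b3))
           * (kernel (q * x) (u / q) / q + (1 - x * u) * pivot x u))
    with (q * Q * x ^ 3 *
      (((1 - b1 / x) * (1 - b2 / x) * (1 - b3 / x) * kernel (q * x) (u / q)) / q
       + (1 - b1 / x) * (1 - b2 / x) * (1 - b3 / x)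
         * ((1 - x * u) * pivot x u))) by (field; now split).
  rewrite Ep. rewrite Hu. unfold reduced_mid.
  generalize (pivot x u). intros p. rewrite Eu.
  field [rel]. now repeat split.
Qed.

Lemma reduced_equation_moving_base (x u vd vm vu : C) :
  x <> 0 -> Q * x * u = q ->
  P (x * u) <> 0 ->
  P (Q * b1 * u / q) <> 0 -> P (Q * b2 * u / q) <> 0 ->
  P (Q * b3 * u / q) <> 0 ->
  is_series (V := C_NormedModule)
    (fun n => q ^ n * kernel (x / q) (q * u * q ^ n)) vd ->
  is_series (V := C_NormedModule)
    (fun n => q ^ n * kernel x (u * q ^ n)) vm ->
  is_series (V := C_NormedModule)
    (fun n => q ^ n * kernel (q * x) (u / q * q ^ n)) vu ->
  u * Q / q * reduced_op x (q * vd) vm (vu / q) = - (1 - Q) * x ^ 2.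
Proof.
  intros Hx0 Hu Hx H1 H2 H3 Hd Hm Hs. pose proof q_neq0 as Hq.
  pose proof (boundary_terms x u Hx0 Hu Hx H1 H2 H3) as Hb.
  assert (Hstep : forall b, P (Q * b * u / q) <> 0 -> P (Q * b * (q * u)) <> 0).
  { intros b. rewrite (qpoch_inf_step (Q * b * u / q) (Q * b * u))
      by (field; trivial).
    rewrite (qpoch_inf_step (Q * b * u) (Q * b * (q * u))) by ring.
    eauto using Cmult_neq0_r. }
  assert (Hm' : is_series (V := C_NormedModule)
            (fun n => q ^ n * kernel x (q * u * q ^ n))
            (/ q * (vm - kernel x u))).
  { apply is_series_tail, (is_series_scal (V := C_NormedModule) (/ q)) in Hm.
    replace (q ^ 0 * kernel x (u * q ^ 0)) with (kernel x u) in Hm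
      by (simpl; now rewrite Cmult_1_r, Cmult_1_l).
    revert Hm. apply is_series_ext. intros n.
    change (/ q * (q ^ S n * kernel x (u * q ^ S n))
            = q ^ n * kernel x (q * u * q ^ n)).
    rewrite Cpow_S. replace (u * (q * q ^ n)) with (q * u * q ^ n) by ring.
    field. trivial. }
  assert (Hs' : is_series (V := C_NormedModule)
            (fun n => q ^ n * kernel (q * x) (q * u * q ^ n))
            (/ (q * q) * (vu - kernel (q * x) (u / q) - q * kernel (q * x) u))).
  { apply is_series_tail, is_series_tail,
      (is_series_scal (V := C_NormedModule) (/ (q * q))) in Hs.
    replace (q ^ 0 * kernel (q * x) (u / q * q ^ 0))
      with (kernel (q * x) (u / q)) in Hs
      by (simpl; now rewrite Cmult_1_r, Cmult_1_l).
    replace (q ^ 1 * kernel (q * x) (u / q * q ^ 1))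
      with (q * kernel (q * x) u) in Hs
      by (rewrite Cpow_1_r; do 2 f_equal; field; trivial).
    revert Hs. apply is_series_ext. intros n.
    change (/ (q * q) * (q ^ S (S n) * kernel (q * x) (u / q * q ^ S (S n)))
            = q ^ n * kernel (q * x) (q * u * q ^ n)).
    rewrite !Cpow_S.
    replace (u / q * (q * (q * q ^ n))) with (q * u * q ^ n)
      by (field; trivial).
    field. trivial. }
  pose proof (fun h => telescoped_series x (q * u) _ _ _ h (Hstep _ H1) (Hstep _ H2) (Hstep _ H3)
    Hd Hm' Hs') as E.
  replace (x * (q * u) / q) with (x * u) in E by (field; trivial).
  specialize (E Hx).
  transitivity (- (1 - Q) * x ^ 2 * (1 - flux x (q * u))
                + - (1 - Q) * x ^ 2 * flux x (q * u)); [|ring].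
  rewrite <- Hb, <- E. unfold reduced_op. field. now split.
Qed.

Lemma reduced_equation_fixed_base (x u vd vm vu : C) :
  a1 * u = q ->
  P (x * u / q) <> 0 ->
  P (Q * b1 * u) <> 0 -> P (Q * b2 * u) <> 0 -> P (Q * b3 * u) <> 0 ->
  is_series (V := C_NormedModule)
    (fun n => q ^ n * kernel (x / q) (u * q ^ n)) vd ->
  is_series (V := C_NormedModule)
    (fun n => q ^ n * kernel x (u * q ^ n)) vm ->
  is_series (V := C_NormedModule)
    (fun n => q ^ n * kernel (q * x) (u * q ^ n)) vu ->
  u * Q / q * reduced_op x vd vm vu = - (1 - Q) * x ^ 2.
Proof.
  intros Hu Hx H1 H2 H3 Hd Hm Hs.
  rewrite (telescoped_series x u vd vm vu) by trivial.
  unfold flux. rewrite Hu.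
  replace (q / q) with (RtoC 1) by (field; apply q_neq0).
  rewrite qpoch_inf_1. unfold Cdiv. ring.
Qed.

End Telescoping.
End QPochhammer.

(** * Powers and the reduced equation *)

Lemma Cexp_add (a b : C) : Cexp (a + b) = Cexp a * Cexp b.
Proof.
  destruct a as [a a'], b as [b b']. unfold Cexp. simpl.
  rewrite exp_plus, cos_plus, sin_plus. unfold Cmult. simpl. f_equal; ring.
Qed.

Lemma Cexp_0 : Cexp 0 = 1.
Proof.
  unfold Cexp. simpl. rewrite exp_0, cos_0, sin_0. unfold RtoC. f_equal; ring.
Qed.

Lemma Cexp_neq0 (a : C) : Cexp a <> 0.
Proof.
  intros E. assert (H : Cexp (a + - a) = 1) by (rewrite Cplus_opp_r; apply Cexp_0).
  rewrite Cexp_add, E in H. rewrite Cmult_0_l in H.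
  apply (f_equal fst) in H. simpl in H. lra.
Qed.

Lemma Cexp_opp (a : C) : Cexp (- a) = / Cexp a.
Proof.
  assert (H : Cexp a * Cexp (- a) = 1)
    by (rewrite <- Cexp_add, Cplus_opp_r; apply Cexp_0).
  pose proof (Cexp_neq0 a).
  replace (Cexp (- a)) with (/ Cexp a * (Cexp a * Cexp (- a))) by (field; trivial).
  rewrite H. ring.
Qed.

Section Exponents.

Variables (q logq : C).
Hypothesis hlogq : Cexp logq = q.

Local Notation E := (qpow logq).

Lemma qpow_add (a b : C) : E (a + b) = E a * E b.
Proof. unfold qpow. now rewrite Cmult_plus_distr_r, Cexp_add. Qed.

Lemma qpow_opp (a : C) : E (- a) = / E a.
Proof. unfold qpow. rewrite <- Cexp_opp. f_equal. ring. Qed.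

Lemma qpow_sub (a b : C) : E (a - b) = E a / E b.
Proof. unfold Cminus. now rewrite qpow_add, qpow_opp. Qed.

Lemma qpow_neq0 (a : C) : E a <> 0.
Proof. apply Cexp_neq0. Qed.

Lemma qpow_1 : E 1 = q.
Proof. unfold qpow. now rewrite Cmult_1_l. Qed.

Lemma qpow_half_sqr (a : C) : E (a / 2) * E (a / 2) = E a.
Proof. rewrite <- qpow_add. f_equal. field. Qed.

Lemma qpow_half : E (1 / 2) * E (1 / 2) = q.
Proof. rewrite qpow_half_sqr. apply qpow_1. Qed.

Lemma qpow_double (a : C) : E (2 * a) = E a * E a.
Proof. rewrite <- qpow_add. f_equal. ring. Qed.

Variables (L : C -> C) (t h l : nat -> C) (alpha : C).
Hypothesis hL : orbit_log logq L.

Local Notation lam := (lambda h l).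
Local Notation Q := (E (lambda h l)).

Definition root_down (j : nat) : C := E (h j + 1 / 2) * t j.
Definition root_up (j : nat) : C := E (l j - 1 / 2) * t j.

Lemma qpow_lambda_sqr :
  Q * Q * (E (l 1%nat) * E (l 2%nat) * E (l 3%nat))
  = q * (E (h 1%nat) * E (h 2%nat) * E (h 3%nat)).
Proof.
  rewrite <- qpow_1, <- !qpow_add. f_equal. unfold lambda. field.
Qed.

Lemma q_qpow_neq0 : q <> 0.
Proof. rewrite <- hlogq. apply Cexp_neq0. Qed.

(** The relation that makes the identity telescope; it is the definition of
    lambda, exponentiated. *)
Lemma roots_rel :
  root_down 1 * root_down 2 * root_down 3
  = q ^ 2 * Q ^ 2 * (root_up 1 * root_up 2 * root_up 3).
Proof.
  unfold root_down, root_up. rewrite !qpow_add, !qpow_sub.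
  pose proof qpow_half as Hp. pose proof qpow_lambda_sqr as HQ.
  pose proof (qpow_neq0 (1 / 2)) as Hp0.
  revert Hp HQ Hp0. generalize (E (1 / 2)) Q (E (h 1%nat)) (E (h 2%nat))
    (E (h 3%nat)) (E (l 1%nat)) (E (l 2%nat)) (E (l 3%nat)).
  intros p u H1 H2 H3 L1 L2 L3 Hp HQ Hp0.
  transitivity (p ^ 3 / q * (q * (H1 * H2 * H3))
                * (t 1%nat * t 2%nat * t 3%nat)).
  - rewrite <- Hp. field. trivial.
  - rewrite <- HQ, <- Hp. field. trivial.
Qed.

Lemma coef_down_roots (x : C) :
  coef_down logq t h x = (x - root_down 1) * (x - root_down 2) * (x - root_down 3).
Proof. reflexivity. Qed.

Lemma coef_up_roots (x : C) :
  coef_up logq t l alpha x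
  = q * E alpha ^ 2 * ((x - root_up 1) * (x - root_up 2) * (x - root_up 3)).
Proof.
  unfold coef_up. rewrite (qpow_add (2 * alpha) 1), qpow_1, qpow_double.
  unfold root_up. ring.
Qed.

(** The half-sums of exponents are expressed through Q, and the definition of
    lambda, in the form Q^2 L_1 L_2 L_3 = q H_1 H_2 H_3 with H_j = q^(h_j) and
    L_j = q^(l_j), turns Q L_1 L_2 L_3 t_2 t_3 / H_1 into a_2 a_3 / Q. *)
Lemma coef_mid_roots (x : C) :
  coef_mid q logq t h l alpha x
  = E alpha * reduced_mid q Q (root_down 1) (root_down 2) (root_down 3)
      (root_up 1) (root_up 2) (root_up 3) x.
Proof.
  unfold coef_mid, reduced_mid, root_down, root_up.
  assert (E1 : E ((h 1%nat + h 2%nat + h 3%nat + l 1%nat + l 2%nat + l 3%nat + 1) / 2)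
    = Q * (E (l 1%nat) * E (l 2%nat) * E (l 3%nat))).
  { rewrite <- !qpow_add. f_equal. unfold lambda. field. }
  assert (E2 : E ((h 1%nat + h 2%nat + h 3%nat + l 1%nat + l 2%nat + l 3%nat) / 2)
    = Q * (E (l 1%nat) * E (l 2%nat) * E (l 3%nat)) / E (1 / 2)).
  { rewrite <- !qpow_add, <- qpow_sub. f_equal. unfold lambda. field. }
  rewrite E1, E2, !qpow_add, !qpow_sub, !qpow_opp.
  pose proof qpow_half as Hp. pose proof qpow_lambda_sqr as HQ.
  pose proof (qpow_neq0 (1 / 2)) as Hp0.
  pose proof (qpow_neq0 (h 1%nat)) as h1. pose proof (qpow_neq0 (h 2%nat)) as h2.
  pose proof (qpow_neq0 (h 3%nat)) as h3. pose proof (qpow_neq0 (l 1%nat)) as l1.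
  pose proof (qpow_neq0 (l 2%nat)) as l2. pose proof (qpow_neq0 (l 3%nat)) as l3.
  pose proof (qpow_neq0 lam) as l0.
  clear E1 E2. f_equal.
  revert Hp HQ Hp0 h1 h2 h3 l1 l2 l3 l0.
  generalize (E (1 / 2)) Q (E (h 1%nat)) (E (h 2%nat))
    (E (h 3%nat)) (E (l 1%nat)) (E (l 2%nat)) (E (l 3%nat)).
  generalize (t 1%nat) (t 2%nat) (t 3%nat).
  intros t1 t2 t3 p u H1 H2 H3 L1 L2 L3 Hp HQ Hp0 h1 h2 h3 l1 l2 l3 l0.
  assert (EH : forall a b c : C, a <> 0 -> b <> 0 -> c <> 0 ->
    u * u * (L1 * L2 * L3) = q * (a * b * c) ->
    u * (L1 * L2 * L3) * / a = p * b * (p * c) / u).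
  { intros a b c Ha Hb Hc Hr.
    replace (u * (L1 * L2 * L3) * / a)
      with (u * u * (L1 * L2 * L3) / (u * a)) by (field; now split).
    rewrite Hr, <- Hp. field. now split. }
  pose proof (EH H1 H2 H3 h1 h2 h3 HQ) as EH1.
  pose proof (EH H2 H1 H3 h2 h1 h3 ltac:(rewrite HQ; ring)) as EH2.
  pose proof (EH H3 H1 H2 h3 h1 h2 ltac:(rewrite HQ; ring)) as EH3.
  transitivity (- (q + 1) * x ^ 3
    + p * ((H1 + L1) * t1 + (H2 + L2) * t2 + (H3 + L3) * t3) * x ^ 2
    - ((u * (L1 * L2 * L3) * / H1) * (t2 * t3)
       + (u * (L1 * L2 * L3) * / H2) * (t1 * t3)
       + (u * (L1 * L2 * L3) * / H3) * (t1 * t2)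
       + u * (L2 * L3 * (t2 * t3) + L1 * L3 * (t1 * t3)
              + L1 * L2 * (t1 * t2))) * x
    + u * (L1 * L2 * L3) / p * (q + 1) * (t1 * t2 * t3)).
  - field. now repeat split.
  - rewrite EH1, EH2, EH3, <- Hp. field. now repeat split.
Qed.

Lemma xpow_scale_up (x a : C) : x <> 0 -> xpow L (q * x) a = E a * xpow L x a.
Proof.
  intros Hx. destruct (hL x Hx) as [_ H]. specialize (H 1%Z).
  rewrite qpow_1 in H. unfold xpow, qpow. rewrite H, <- Cexp_add.
  f_equal. ring.
Qed.

Lemma xpow_scale_down (x a : C) : x <> 0 -> xpow L (x / q) a = xpow L x a / E a.
Proof.
  intros Hx. pose proof q_qpow_neq0 as Hq. pose proof (qpow_neq0 a) as Ha.
  replace (xpow L x a) with (E a * xpow L (x / q) a).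
  - field. trivial.
  - rewrite <- xpow_scale_up.
    + f_equal. field. trivial.
    + intros H. apply Hx. replace x with (q * (x / q)) by (field; trivial).
      rewrite H. ring.
Qed.

Lemma xpow_add (x a b : C) : xpow L x (a + b) = xpow L x a * xpow L x b.
Proof. unfold xpow. now rewrite Cmult_plus_distr_r, Cexp_add. Qed.

Lemma xpow_1 (x : C) : x <> 0 -> xpow L x 1 = x.
Proof.
  intros Hx. unfold xpow. rewrite Cmult_1_l. now destruct (hL x Hx).
Qed.

Lemma satisfies_eq_reduced (g : C -> C) (x vd vm vu : C) :
  x <> 0 ->
  g (x / q) = xpow L (x / q) (lam - alpha) * vd ->
  g x = xpow L x (lam - alpha) * vm ->
  g (q * x) = xpow L (q * x) (lam - alpha) * vu ->
  reduced_op q Q (root_down 1) (root_down 2) (root_down 3)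
    (root_up 1) (root_up 2) (root_up 3) x vd vm vu = - (1 - Q) * x ^ 2 ->
  satisfies_eq q logq L t h l alpha g x.
Proof.
  intros Hx Ed Em Eu H. unfold satisfies_eq.
  rewrite Ed, Em, Eu, coef_down_roots, coef_up_roots, coef_mid_roots.
  rewrite xpow_scale_up, xpow_scale_down by trivial.
  replace (lam - alpha + 2) with (lam - alpha + 1 + 1) by ring.
  rewrite !(xpow_add x _ 1), xpow_1, !qpow_sub by trivial.
  pose proof (qpow_neq0 lam). pose proof (qpow_neq0 alpha).
  transitivity (E alpha * xpow L x (lam - alpha) *
    (reduced_op q Q (root_down 1) (root_down 2) (root_down 3)
      (root_up 1) (root_up 2) (root_up 3) x vd vm vu + (1 - Q) * x ^ 2)).
  - unfold reduced_op. field. now split.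
  - rewrite H. ring.
Qed.

Hypothesis hq : (0 < Cmod q < 1)%R.

(** * The two families of solutions *)

Lemma reduced_op_scale (Q' a1 a2 a3 b1 b2 b3 x k vd vm vu : C) :
  reduced_op q Q' a1 a2 a3 b1 b2 b3 x (k * vd) (k * vm) (k * vu)
  = k * reduced_op q Q' a1 a2 a3 b1 b2 b3 x vd vm vu.
Proof. unfold reduced_op. ring. Qed.

Lemma qpochs_inf_cons_neq0 (a : C) (s : list C) :
  qpochs_inf (a :: s) q <> 0 -> qpoch_inf a q <> 0 /\ qpochs_inf s q <> 0.
Proof.
  intros H. split.
  - exact (Cmult_neq0_l _ _ H).
  - exact (Cmult_neq0_r _ _ H).
Qed.

(** The point q / a_i, at which the factor P(a_i s / q) of the flux vanishes. *)
Definition fixed_base (i : nat) : C := E (1 / 2 - h i) / t i.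

Lemma fixed_base_root (i : nat) : t i <> 0 -> root_down i * fixed_base i = q.
Proof.
  intros Ht. unfold root_down, fixed_base. rewrite qpow_add, qpow_sub.
  pose proof (qpow_neq0 (h i)). rewrite <- qpow_half. field. now split.
Qed.

Lemma fixed_param_x (i : nat) (y : C) :
  y * E (- h i + 1 / 2) / t i = y * fixed_base i.
Proof.
  unfold fixed_base, Cdiv. rewrite <- Cmult_assoc. do 3 f_equal. ring.
Qed.

Lemma fixed_param_Qx (i : nat) (y : C) :
  y * E (lam - h i + 1 / 2) / t i = Q * y * fixed_base i.
Proof.
  unfold fixed_base.
  replace (lam - h i + 1 / 2) with (lam + (1 / 2 - h i)) by ring.
  rewrite qpow_add. unfold Cdiv. ring.
Qed.

Lemma fixed_param_down (i j : nat) :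
  E (h j - h i + 1) * t j / t i = root_down j * fixed_base i.
Proof.
  unfold root_down, fixed_base.
  replace (h j - h i + 1) with ((h j + 1 / 2) + (1 / 2 - h i)) by field.
  rewrite (qpow_add (h j + 1 / 2)). unfold Cdiv. ring.
Qed.

Lemma fixed_param_up (i j : nat) :
  E (lam + l j - h i) * t j / t i = Q * root_up j * fixed_base i.
Proof.
  unfold root_up, fixed_base.
  replace (lam + l j - h i) with (lam + (l j - 1 / 2) + (1 / 2 - h i)) by ring.
  rewrite (qpow_add _ (1 / 2 - h i)), (qpow_add lam). unfold Cdiv. ring.
Qed.

Lemma fixed_param_up_diag (i : nat) :
  t i <> 0 -> E (lam + l i - h i) = Q * root_up i * fixed_base i.
Proof. intros Ht. rewrite <- fixed_param_up. field. trivial. Qed.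

Lemma fixed_prefactor (i : nat) :
  E (lam - h i - 1 / 2) / t i = fixed_base i * Q / q.
Proof.
  unfold fixed_base.
  replace (lam - h i - 1 / 2) with (lam + (1 / 2 - h i) - 1) by field.
  rewrite (qpow_sub _ 1), qpow_add, qpow_1. unfold Cdiv. ring.
Qed.

Lemma g_i_series (i i' i'' : nat) (y : C) :
  t i <> 0 ->
  g_i_defined q logq t h l i i' i'' y ->
  exists v,
    is_series (V := C_NormedModule)
      (fun n => q ^ n * kernel q Q (root_down i) (root_down i') (root_down i'')
         (root_up i) (root_up i') (root_up i'') y (fixed_base i * q ^ n)) v
    /\ g_i q logq L t h l alpha i i' i'' y
       = xpow L y (lam - alpha) * (fixed_base i * Q / q * v).
Proof.
  intros Ht [Ha Hc]. unfold g_i.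
  rewrite fixed_param_x, fixed_param_Qx, !fixed_param_down, !fixed_param_up,
    fixed_param_up_diag in * by trivial.
  eexists. split.
  - apply (is_series_ext (V := C_NormedModule)) with
      (2 := phi43_series q hq _ _ _ _ _ _ _ Ha Hc).
    intros n. apply f_equal. unfold kernel.
    rewrite !Cmult_assoc, fixed_base_root by trivial.
    unfold Cdiv. f_equal. ring.
  - rewrite fixed_prefactor. ring.
Qed.

(** The equation does not change when the pairs (a_j, b_j) are permuted, which
    is what the symmetry hypothesis records for the chosen order. *)
Lemma g_i_satisfies_eq (i i' i'' : nat) (x : C) :
  t i <> 0 ->
  (root_down i * root_down i' * root_down i''
   = q ^ 2 * Q ^ 2 * (root_up i * root_up i' * root_up i'')) ->
  (forall vd vm vu,
     reduced_op q Q (root_down i) (root_down i') (root_down i'')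
       (root_up i) (root_up i') (root_up i'') x vd vm vu
     = reduced_op q Q (root_down 1) (root_down 2) (root_down 3)
         (root_up 1) (root_up 2) (root_up 3) x vd vm vu) ->
  x <> 0 ->
  g_i_defined q logq t h l i i' i'' (x / q) ->
  g_i_defined q logq t h l i i' i'' x ->
  g_i_defined q logq t h l i i' i'' (q * x) ->
  satisfies_eq q logq L t h l alpha (g_i q logq L t h l alpha i i' i'') x.
Proof.
  intros Ht Hrel Hsym Hx Dd Dm Du. pose proof q_qpow_neq0 as Hq.
  destruct (g_i_series i i' i'' _ Ht Dd) as (vd & Sd & Ed).
  destruct (g_i_series i i' i'' _ Ht Dm) as (vm & Sm & Em).
  destruct (g_i_series i i' i'' _ Ht Du) as (vu & Su & Eu).
  apply (satisfies_eq_reduced _ _ _ _ _ Hx Ed Em Eu).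
  rewrite reduced_op_scale, <- Hsym.
  destruct Dd as [Da _].
  rewrite fixed_param_x, !fixed_param_up, fixed_param_up_diag in Da by trivial.
  apply qpochs_inf_cons_neq0 in Da as [D0 Da].
  apply qpochs_inf_cons_neq0 in Da as [D1 Da].
  apply qpochs_inf_cons_neq0 in Da as [D2 Da].
  apply qpochs_inf_cons_neq0 in Da as [D3 _].
  apply reduced_equation_fixed_base; trivial.
  - apply qpow_neq0.
  - now apply fixed_base_root.
  - now replace (x * fixed_base i / q) with (x / q * fixed_base i)
      by (field; trivial).
Qed.

(** The base point of the moving sum at y is q / (Q y), where P(Q y s) = P(q)
    plays the part of the product (q; q)_oo in the prefactor. *)
Lemma moving_param_down (j : nat) (y : C) :
  y <> 0 ->
  E (- lam + h j + 3 / 2) * t j / y = root_down j * (q / (Q * y)).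
Proof.
  intros Hy. unfold root_down.
  replace (- lam + h j + 3 / 2) with ((h j + 1 / 2) + 1 - lam) by field.
  rewrite qpow_sub, (qpow_add _ 1), qpow_1. pose proof (qpow_neq0 lam).
  field. now split.
Qed.

Lemma moving_param_up (j : nat) (y : C) :
  y <> 0 ->
  E (l j + 1 / 2) * t j / y = Q * root_up j * (q / (Q * y)).
Proof.
  intros Hy. unfold root_up.
  replace (l j + 1 / 2) with ((l j - 1 / 2) + 1) by field.
  rewrite (qpow_add _ 1), qpow_1. pose proof (qpow_neq0 lam).
  field. now split.
Qed.

Lemma moving_param_x (y : C) : y <> 0 -> E (1 - lam) = y * (q / (Q * y)).
Proof.
  intros Hy. rewrite qpow_sub, qpow_1. pose proof (qpow_neq0 lam).
  field. now split.
Qed.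

Lemma g_0_series (y : C) :
  y <> 0 ->
  g_0_defined q logq t h l y ->
  exists v,
    is_series (V := C_NormedModule)
      (fun n => q ^ n * kernel q Q (root_down 1) (root_down 2) (root_down 3)
         (root_up 1) (root_up 2) (root_up 3) y (q / (Q * y) * q ^ n)) v
    /\ g_0 q logq L t h l alpha y
       = xpow L y (lam - alpha) * (q / (Q * y) * Q / q * v).
Proof.
  intros Hy [Ha Hc]. unfold g_0.
  rewrite !moving_param_down, !moving_param_up, (moving_param_x y) in *
    by trivial.
  pose proof (qpow_neq0 lam) as HQ. pose proof q_qpow_neq0 as Hq.
  eexists. split.
  - apply (is_series_ext (V := C_NormedModule)) with
      (2 := phi43_series q hq _ _ _ _ _ _ _ Ha Hc).
    intros n. apply f_equal. unfold kernel.
    replace (Q * y * (q / (Q * y) * q ^ n)) with (q * q ^ n)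
      by (field; now split).
    rewrite !Cmult_assoc.
    unfold Cdiv. f_equal; [|f_equal]; ring.
  - replace (xpow L y (lam - alpha)) with (y * xpow L y (lam - alpha - 1)).
    + field. now repeat split.
    + replace (lam - alpha) with (lam - alpha - 1 + 1) at 2 by ring.
      rewrite xpow_add, xpow_1 by trivial. ring.
Qed.

Lemma g_0_satisfies_eq (x : C) :
  x <> 0 ->
  g_0_defined q logq t h l (x / q) ->
  g_0_defined q logq t h l x ->
  g_0_defined q logq t h l (q * x) ->
  satisfies_eq q logq L t h l alpha (g_0 q logq L t h l alpha) x.
Proof.
  intros Hx Dd Dm Du.
  pose proof q_qpow_neq0 as Hq. pose proof (qpow_neq0 lam) as HQ.
  assert (Hxd : x / q <> 0).
  { intros H0. apply Hx. replace x with (q * (x / q)) by (field; trivial).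
    rewrite H0. ring. }
  assert (Hxu : q * x <> 0) by now apply Cmult_neq_0.
  destruct (g_0_series _ Hxd Dd) as (vd & Sd & Ed).
  destruct (g_0_series _ Hx Dm) as (vm & Sm & Em).
  destruct (g_0_series _ Hxu Du) as (vu & Su & Eu).
  set (u := q / (Q * x)) in *.
  replace (q / (Q * (x / q))) with (q * u) in *
    by (unfold u; field; now repeat split).
  replace (q / (Q * (q * x))) with (u / q) in *
    by (unfold u; field; now repeat split).
  replace (q * u * Q / q * vd) with (u * Q / q * (q * vd)) in Ed
    by (field; trivial).
  replace (u / q * Q / q * vu) with (u * Q / q * (vu / q)) in Eu
    by (field; trivial).
  apply (satisfies_eq_reduced _ _ _ _ _ Hx Ed Em Eu).
  rewrite reduced_op_scale.
  destruct Du as [Da _].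
  rewrite !moving_param_up, (moving_param_x x) in Da by trivial.
  replace (q / (Q * (q * x))) with (u / q) in Da
    by (unfold u; field; now repeat split).
  apply qpochs_inf_cons_neq0 in Da as [D1 Da].
  apply qpochs_inf_cons_neq0 in Da as [D2 Da].
  apply qpochs_inf_cons_neq0 in Da as [D3 Da].
  apply qpochs_inf_cons_neq0 in Da as [D0 _].
  assert (Hdiv : forall b : C, Q * b * u / q = Q * b * (u / q))
    by (intros; unfold Cdiv; ring).
  apply reduced_equation_moving_base; rewrite ?Hdiv; trivial.
  - apply roots_rel.
  - unfold u. field. now split.
Qed.

End Exponents.

Theorem theorem4p10
  (q logq : C) (L : C -> C) (t h l : nat -> C) (alpha : C)
  (hq : (0 < Cmod q < 1)%R)
  (hlogq : Cexp logq = q)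
  (hL : orbit_log logq L)
  (ht_neq0 : t 1%nat <> 0 /\ t 2%nat <> 0 /\ t 3%nat <> 0)
  (ht_distinct :
     t 1%nat <> t 2%nat /\ t 1%nat <> t 3%nat /\ t 2%nat <> t 3%nat) :
  (forall (i i' i'' : nat) (x : C),
     Permutation [i; i'; i''] [1; 2; 3]%nat ->
     x <> 0 ->
     g_i_defined q logq t h l i i' i'' (x / q) ->
     g_i_defined q logq t h l i i' i'' x ->
     g_i_defined q logq t h l i i' i'' (q * x) ->
     satisfies_eq q logq L t h l alpha
       (g_i q logq L t h l alpha i i' i'') x)
  /\
  (forall x : C,
     x <> 0 ->
     g_0_defined q logq t h l (x / q) ->
     g_0_defined q logq t h l x ->
     g_0_defined q logq t h l (q * x) ->
     satisfies_eq q logq L t h l alpha (g_0 q logq L t h l alpha) x).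
Proof.
  destruct ht_neq0 as (t1 & t2 & t3). split.
  - intros i i' i'' x Hp Hx Dd Dm Du.
    pose proof (roots_rel q logq hlogq t h l) as Hrel.
    assert (Hin : forall j, In j [i; i'; i''] -> In j [1; 2; 3]%nat)
      by (intros j; apply Permutation_in; trivial).
    assert (Hnd : NoDup [i; i'; i'']).
    { apply (Permutation_NoDup (Permutation_sym Hp)).
      repeat constructor; simpl; lia. }
    inversion_clear Hnd as [|? ? N1 N2]. inversion_clear N2 as [|? ? N3 _].
    simpl in N1, N3.
    assert (I1 := Hin i ltac:(simpl; tauto)).
    assert (I2 := Hin i' ltac:(simpl; tauto)).
    assert (I3 := Hin i'' ltac:(simpl; tauto)).
    simpl in I1, I2, I3.
    (* The six genuine permutations survive; in each the relation between the
       roots and the reduced operator are symmetric. *)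
    destruct I1 as [<-|[<-|[<-|[]]]]; destruct I2 as [<-|[<-|[<-|[]]]];
      try (exfalso; tauto); destruct I3 as [<-|[<-|[<-|[]]]];
      try (exfalso; tauto);
      apply (g_i_satisfies_eq q logq hlogq L t h l alpha hL hq); trivial;
      try (intros; unfold reduced_op, reduced_mid, Cdiv; ring);
      transitivity (root_down logq t h 1 * root_down logq t h 2
                    * root_down logq t h 3);
      (ring || (rewrite Hrel; ring)).
  - intros x Hx Dd Dm Du.
    now apply (g_0_satisfies_eq q logq hlogq L t h l alpha hL hq).
Qed.
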